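(* Consider a network with $L$ nodes, $n$ edges (unknown transfer functions) and $s$ sinks, with true network matrix $G^0(q)$ and set of measured nodes $\mathcal C$. If the whole network is identifiable from the measurements of $\mathcal C$, then $\mathcal C$ contains all $s$ sinks and, denoting by $m$ the number of measured nodes that are not sinks, $$m+s\;\geq\;\frac{n}{L-s}.$$
   Context: Network: a directed graph without self-loops on $\{1,\dots,L\}$, whose topology is known, together with an $L\times L$ matrix $G^0(q)$ of proper real rational transfer functions. $G^0_{ij}$ is the transfer function of the edge from node $j$ to node $i$; $G^0_{ij}\neq 0$ if and only if there is an edge from $j$ to $i$; $G^0_{ii}=0$. There is a delay in every cycle and $I-G^0$ is invertible with $(I-G^0)^{-1}$ proper and stable; $T^0=(I-G^0)^{-1}$. The node signals satisfy $w=G^0w+r$, $y=Cw$, where every node is excited by a known, sufficiently rich signal $r_i$ (mutually uncorrelated), and $C$ is the $p\times L$ selection matrix ($0/1$, one $1$ per row) of the set $\mathcal C$ of $p$ measured nodes. Thus $CT^0$ is known exactly. A matrix $G$ of proper rational transfer functions is consistent with the graph if $G_{ij}=0$ whenever there is no edge from $j$ to $i$. The whole network is identifiable if every $G$ consistent with the graph and satisfying $CT^0(I-G)=C$ equals $G^0$. A sink is a node with only incoming edges (at least one incoming, no outgoing edge). *)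

(* Defs.v *)
From mathcomp Require Import all_boot all_order all_algebra.
From mathcomp Require Import fraction complex reals.

Set Implicit Arguments.
Unset Strict Implicit.
Unset Printing Implicit Defensive.

Import Order.TTheory GRing.Theory Num.Theory.

Local Open Scope ring_scope.
Local Open Scope complex_scope.

(* Real rational transfer functions, in the forward shift operator q (the      *)
(* polynomial variable): q^-1 is a one-step delay.                            *)
Notation tf R := {fraction {poly R}}.

Definition tf_of (R : realType) (num den : {poly R}) : tf R :=
  tofrac num / tofrac den.

(* deg num <= deg den; this does not depend on the fraction representing f. *)
Definition proper_tf (R : realType) (f : tf R) : Prop :=
  exists num den : {poly R},
    [/\ den != 0, f = tf_of num den & (size num <= size den)%N].

(* Proper with a delay: deg num < deg den (also true of f = 0). *)
Definition delayed_tf (R : realType) (f : tf R) : Prop :=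
  exists num den : {poly R},
    [/\ den != 0, f = tf_of num den & (size num < size den)%N].

(* The finite poles: complex roots of the denominator in lowest terms. *)
Definition pole (R : realType) (f : tf R) (z : R[i]) : Prop :=
  exists num den : {poly R},
    [/\ den != 0, coprimep num den, f = tf_of num den
      & root (map_poly (real_complex R) den) z].

(* Discrete-time stability: all poles lie in the open unit disc. *)
Definition stable_tf (R : realType) (f : tf R) : Prop :=
  forall z : R[i], pole f z -> `|z| < 1.

(* Rows are the heads of the edges: G0 i j is the transfer function of the     *)
(* edge j -> i, whose presence is [edge j i].                                 *)
Record network (R : realType) (L : nat) := Network {
  edge : rel 'I_L;
  G0 : 'M[tf R]_L;
  edge_irr : irreflexive edge;
  G0_proper : forall i j, proper_tf (G0 i j);
  G0_edge : forall i j, (G0 i j != 0) = edge j i;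
  (* Some edge of each cycle is strictly proper; as all the entries of G0 are *)
  (* proper, this says that the product along the cycle is strictly proper.  *)
  G0_delay : forall c : seq 'I_L, c != [::] -> ucycle edge c ->
    exists2 j, j \in c & delayed_tf (G0 (next c j) j);
  IG0_unit : 1%:M - G0 \in unitmx;
  T0_proper : forall i j, proper_tf (invmx (1%:M - G0) i j);
  T0_stable : forall i j, stable_tf (invmx (1%:M - G0) i j)
}.

Definition T0 (R : realType) (L : nat) (N : network R L) : 'M[tf R]_L :=
  invmx (1%:M - G0 N).

Definition selection_mx (R : realType) (L : nat) (C : {set 'I_L}) :
    'M[tf R]_(#|C|, L) :=
  \matrix_(k < #|C|, j < L) (enum_val k == j)%:R.

Definition consistent (R : realType) (L : nat) (N : network R L)
    (G : 'M[tf R]_L) : Prop :=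
  (forall i j, proper_tf (G i j)) /\
  (forall i j, ~~ edge N j i -> G i j = 0).

Definition identifiable (R : realType) (L : nat) (N : network R L)
    (C : {set 'I_L}) : Prop :=
  forall G : 'M[tf R]_L, consistent N G ->
    selection_mx R C *m T0 N *m (1%:M - G) = selection_mx R C -> G = G0 N.

Definition edges (R : realType) (L : nat) (N : network R L) :
    {set 'I_L * 'I_L} := [set a | edge N a.1 a.2].

Definition sinks (R : realType) (L : nat) (N : network R L) : {set 'I_L} :=
  [set j | [exists i, edge N i j] && [forall i, ~~ edge N j i]].

(* Main.v *)
Require Import Defs.
From mathcomp Require Import all_boot all_order all_algebra.
From mathcomp Require Import fraction generic_quotient reals.

(** Writing G = G0 + D, the equation C T0 (I - G) = C says exactly that
    C T0 D = 0, so identifiability means that C T0 kills no nonzero proper D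
    that is supported on the edges.  This can be read column by column: column j
    of D is supported on the out-neighbours of j, and properness is no
    restriction, because a nonzero vector of rational functions becomes proper
    after multiplication by a large power of the delay q^-1.  Hence C T0 is
    injective on the vectors supported on the out-neighbours of each node
    ([identifiable_inj]).

    Both claims follow.  Counting dimensions, a node has at most #|C|
    out-neighbours; sinks have none, so n <= #|C| * (L - s).  If k is a sink with
    an edge j -> k, then (I - G0) e_k = e_k, hence T0 e_k = e_k, and injectivity
    for j on the line spanned by e_k forces C e_k != 0, that is, k in C. *)

Section Identifiability.

Import GRing.Theory Num.Theory.
Local Open Scope ring_scope.

Local Set Implicit Arguments.
Local Unset Strict Implicit.

Lemma tf_repr (R : realType) (f : tf R) :
  exists num den : {poly R}, den != 0 /\ f = tf_of num den.
Proof.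
elim/quotW: f => x; exists x.1, x.2.
have dx : x.2 != 0 by exact: denom_ratioP.
split=> //; apply: (canRL (mulfK _)); first by rewrite tofrac_eq0.
unlock FracField.tofrac; rewrite -[LHS]FracField.pi_mul.
apply/eqmodP => /=; rewrite /FracField.equivf /FracField.mulf /=.
by rewrite !numden_Ratio ?mulf_neq0 ?oner_neq0 // !mulr1 mulrC.
Qed.

Lemma proper_tfD (R : realType) (f g : tf R) :
  proper_tf f -> proper_tf g -> proper_tf (f + g).
Proof.
move=> [a [b [b0 -> ab]]] [c [d [d0 -> cd]]].
exists (a * d + c * b), (b * d); split; first by rewrite mulf_neq0.
  by rewrite /tf_of addf_div ?tofrac_eq0 // tofracD !tofracM.
rewrite (leq_trans (size_polyD _ _)) // geq_max (size_mul b0 d0).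
have le_pred (x y z t : nat) : (x <= y -> z <= t -> (x + z).-1 <= (y + t).-1)%N.
  by move=> xy zt; rewrite -!subn1 leq_sub2r // leq_add.
apply/andP; split; apply: leq_trans (size_polyMleq _ _) _; first exact: le_pred.
by rewrite addnC le_pred.
Qed.

(** A large power of q^-1 makes finitely many rational functions proper. *)
Lemma scale_proper (R : realType) (I : finType) (f : I -> tf R) :
  exists2 c : tf R, c != 0 & forall i, proper_tf (c * f i).
Proof.
have /fin_all_exists2 [nd nd0 fE] : forall i, exists2 nd : {poly R} * {poly R},
    nd.2 != 0 & f i = tf_of nd.1 nd.2.
  by move=> i; have [n [d [d0 ->]]] := tf_repr (f i); exists (n, d).
pose N := (\max_i size (nd i).1)%N.
have XN0 : 'X^N != 0 :> {poly R} by rewrite monic_neq0 ?monicXn.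
exists (tofrac ('X^N : {poly R}))^-1; first by rewrite invr_eq0 tofrac_eq0.
move=> i; exists (nd i).1, ((nd i).2 * 'X^N).
split; first by rewrite mulf_neq0.
  by rewrite fE /tf_of tofracM invfM mulrC mulrA.
rewrite size_mulXn //; apply: leq_trans (leq_addr _ _).
exact: (leq_bigmax (F := fun i => size (nd i).1)).
Qed.

(** The coordinates outside W are already zero, so there are #|W| unknowns for
    p equations; the vector is found inside the row space of the selection matrix
    of W. *)
Lemma supported_kernel (F : fieldType) (p L : nat) (A : 'M[F]_(p, L))
    (W : {set 'I_L}) : (p < #|W|)%N ->
  exists v : 'cV[F]_L,
    [/\ v != 0, forall i, i \notin W -> v i 0 = 0 & A *m v = 0].
Proof.
move=> pW; pose S : 'M[F]_(#|W|, L) := \matrix_(k, j) (enum_val k == j)%:R.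
have : kermx (S *m A^T) != 0.
  rewrite kermx_eq0 /row_free ltn_eqF //.
  exact: leq_ltn_trans (rank_leq_col _) pW.
case/rowV0Pn => u /sub_kermxP uSA u0; exists (u *m S)^T; split.
- apply: contraNneq u0 => /(congr1 trmx); rewrite trmxK trmx0 => uS0.
  have SST : S *m S^T = 1%:M.
    apply/matrixP => i k; rewrite !mxE (bigD1 (enum_val i)) //= big1.
      by rewrite !mxE eqxx mul1r addr0 (inj_eq enum_val_inj) eq_sym.
    by move=> j ji; rewrite !mxE eq_sym (negPf ji) mul0r.
  by rewrite -[u]mulmx1 -SST mulmxA uS0 mul0mx.
- move=> i iW; rewrite !mxE big1 // => k _; rewrite !mxE.
  case: eqP => [ki|_]; last by rewrite mulr0.
  by case/negP: iW; rewrite -ki enum_valP.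
by apply: trmx_inj; rewrite trmx_mul trmxK -mulmxA trmx0.
Qed.

Definition out_nbrs (R : realType) (L : nat) (N : network R L) (j : 'I_L) :
    {set 'I_L} := [set i | edge N j i].

(** A kernel vector v, rescaled to be proper, can be added to column j of G0
    without changing the measurements. *)
Lemma identifiable_inj (R : realType) (L : nat) (N : network R L)
    (C : {set 'I_L}) (j : 'I_L) (v : 'cV[tf R]_L) :
  identifiable N C -> (forall i, i \notin out_nbrs N j -> v i 0 = 0) ->
  selection_mx R C *m T0 N *m v = 0 -> v = 0.
Proof.
move=> hid vout Av.
have [c c0 cv] := scale_proper (fun i => v i 0).
pose D : 'M[tf R]_L := (c *: v) *m delta_mx 0 j.
have DE i k : D i k = if k == j then c * v i 0 else 0.
  rewrite !mxE big_ord1 !mxE eqxx /=.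
  by case: eqP => _; rewrite ?mulr1 ?mulr0.
have : G0 N + D = G0 N.
  apply: hid; first split=> i k.
  - rewrite mxE DE; case: eqP => _; first exact: proper_tfD (G0_proper _ _ _) (cv i).
    by rewrite addr0; apply: G0_proper.
  - move=> ki; rewrite mxE DE.
    have -> : G0 N i k = 0 by apply/eqP; rewrite -[_ == _]negbK G0_edge.
    rewrite add0r; case: eqP => // kj.
    by rewrite vout ?mulr0 // inE -kj.
  rewrite opprD addrA mulmxBr -!mulmxA mulVmx ?IG0_unit // mulmx1 !mulmxA.
  by rewrite -scalemxAr Av scaler0 mul0mx subr0.
move/(canRL (addKr _)); rewrite addNr => D0.
apply/colP => i; have := DE i j; rewrite D0 mxE eqxx => /esym/eqP.
by rewrite mulf_eq0 (negPf c0) mxE => /eqP.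
Qed.

Lemma out_nbrs_le (R : realType) (L : nat) (N : network R L)
    (C : {set 'I_L}) (j : 'I_L) :
  identifiable N C -> (#|out_nbrs N j| <= #|C|)%N.
Proof.
move=> hid; rewrite leqNgt; apply/negP => lt_C.
have [v [v0 vout Av]] := supported_kernel (selection_mx R C *m T0 N) lt_C.
by case/eqP: v0; apply: identifiable_inj hid vout Av.
Qed.

(** Column k of G0 vanishes, so e_k is fixed by I - G0. *)
Lemma T0_sink (R : realType) (L : nat) (N : network R L) (k : 'I_L) :
  k \in sinks N -> T0 N *m delta_mx k (0 : 'I_1) = delta_mx k 0.
Proof.
rewrite inE => /andP[_ /forallP no_out].
have fix_k : (1%:M - G0 N) *m delta_mx k (0 : 'I_1) = delta_mx k 0.
  rewrite mulmxBl mul1mx -colE; suff -> : col k (G0 N) = 0 by rewrite subr0.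
  by apply/colP => i; rewrite !mxE; apply/eqP; rewrite -[_ == _]negbK G0_edge.
by rewrite -{1}fix_k mulmxA mulVmx ?mul1mx ?IG0_unit.
Qed.

Lemma sinks_measured (R : realType) (L : nat) (N : network R L)
    (C : {set 'I_L}) : identifiable N C -> sinks N \subset C.
Proof.
move=> hid; apply/subsetP => k sk; apply: contraT => kC.
have := sk; rewrite inE => /andP[/existsP[j jk] _].
suff : delta_mx k 0 = 0 :> 'cV[tf R]_L.
  by move/colP/(_ k)/eqP; rewrite !mxE !eqxx oner_eq0.
apply: (identifiable_inj (j := j) hid) => [i|].
  by rewrite !mxE inE; case: eqP => [->|//]; rewrite jk.
rewrite -mulmxA T0_sink // -colE; apply/colP => i; rewrite !mxE.
by case: eqP => // ik; case/negP: kC; rewrite -ik enum_valP.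
Qed.

Lemma card_edges (R : realType) (L : nat) (N : network R L) :
  #|edges N| = (\sum_j #|out_nbrs N j|)%N.
Proof.
rewrite -sum1_card (eq_bigl (fun a => edge N a.1 a.2)); last first.
  by move=> a; rewrite inE.
rewrite -(pair_big_dep xpredT (edge N) (fun _ _ => 1%N)) /=.
by apply: eq_bigr => j _; rewrite -sum1_card; apply: eq_bigl => i; rewrite inE.
Qed.

Lemma edges_le (R : realType) (L : nat) (N : network R L) (C : {set 'I_L}) :
  identifiable N C -> (#|edges N| <= #|C| * (L - #|sinks N|))%N.
Proof.
move=> hid; rewrite card_edges (bigID (mem (sinks N))) /= big1 ?add0n.
  have -> : (L - #|sinks N| = #|[predC sinks N]|)%N.
    by apply: (canLR (addKn _)); rewrite cardC card_ord.
  rewrite mulnC -sum_nat_const.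
  by apply: leq_sum => j _; apply: out_nbrs_le.
move=> j; rewrite inE => /andP[_ /forallP no_out].
by apply: eq_card0 => i; rewrite inE (negPf (no_out i)).
Qed.

(** When s = b, as for the empty network, the quotient is n / 0 = 0. *)
Lemma ratio_le_nat (n a b s : nat) : (s <= b)%N -> (n <= a * (b - s))%N ->
  n%:R / (b%:R - s%:R) <= a%:R :> rat.
Proof.
move=> sb le_n; rewrite -natrB //.
have [->|bs] := posnP (b - s); first by rewrite invr0 mulr0 ler0n.
by rewrite ler_pdivrMr ?ltr0n // -natrM ler_nat.
Qed.

End Identifiability.

Theorem mainTheorem2 (R : realType) (L n s m : nat) (N : network R L)
    (C : {set 'I_L})
    (hn : n = #|edges N|) (hs : s = #|sinks N|) (hm : m = #|C :\: sinks N|)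
    (hid : identifiable N C) :
  sinks N \subset C /\
  (((m + s)%:R : rat) >= n%:R / (L%:R - s%:R))%R.
Proof.
have sC := sinks_measured hid; split=> //.
have -> : m + s = #|C| by rewrite hm hs cardsDS ?subnK ?subset_leq_card.
apply: ratio_le_nat; first by rewrite hs -[leqRHS](card_ord L) max_card.
by rewrite hn hs; apply: edges_le.
Qed.
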